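(* Let $\mathbf A\in\mathbb R^{n\times n}$, $\mathbf F\in\mathbb R^{n\times n^2}$, $\mathbf B\in\mathbb R^{n\times m}$, $\mathbf C\in\mathbb R^{p\times n}$, let $\gamma>\gamma_0\ge 0$, $\eta=1-\gamma^{-2}$, and $d\ge 2$. Let $\mathbf W_2$ be the stabilizing symmetric positive definite solution of $$\mathbf 0=\mathbf A^\top\mathbf W_2+\mathbf W_2\mathbf A+\mathbf C^\top\mathbf C-\eta\,\mathbf W_2\mathbf B\mathbf B^\top\mathbf W_2,$$ and let $\mathbf V_2=\mathbf Y_\infty^{-1}$, where $\mathbf Y_\infty$ is the stabilizing symmetric positive definite solution of $$\mathbf A\mathbf Y_\infty+\mathbf Y_\infty\mathbf A^\top+\mathbf B\mathbf B^\top-\eta\,\mathbf Y_\infty\mathbf C^\top\mathbf C\mathbf Y_\infty=\mathbf 0$$ (so that $\mathbf 0=\mathbf A^\top\mathbf V_2+\mathbf V_2\mathbf A-\eta\mathbf C^\top\mathbf C+\mathbf V_2\mathbf B\mathbf B^\top\mathbf V_2$). Then, for every $k=1,\dots,d$, the matrices $$\mathcal L_k\big((\mathbf A-\eta\mathbf B\mathbf B^\top\mathbf W_2)^\top\big)\quad\text{and}\quad\mathcal L_k\big((\mathbf A+\mathbf B\mathbf B^\top\mathbf V_2)^\top\big)$$ are invertible. Thus, for $2<k\le d$, the linear systems $$\mathcal L_k\big((\mathbf A-\eta\mathbf B\mathbf B^\top\mathbf W_2)^\top\big)\widetilde{\mathbf w}_k=-\mathcal L_{k-1}(\mathbf F^\top)\mathbf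 w_{k-1}+\frac{\eta}{4}\sum_{\substack{i,j>2\\ i+j=k+2}} ij\;\mathrm{vec}(\mathbf W_i^\top\mathbf B\mathbf B^\top\mathbf W_j)$$ and $$\mathcal L_k\big((\mathbf A+\mathbf B\mathbf B^\top\mathbf V_2)^\top\big)\widetilde{\mathbf v}_k=-\mathcal L_{k-1}(\mathbf F^\top)\mathbf v_{k-1}-\frac14\sum_{\substack{i,j>2\\ i+j=k+2}} ij\;\mathrm{vec}(\mathbf V_i^\top\mathbf B\mathbf B^\top\mathbf V_j)$$ have unique solutions $\widetilde{\mathbf w}_k,\widetilde{\mathbf v}_k\in\mathbb R^{n^k}$.
   Context: Notation. $\mathrm{vec}$ stacks columns. For $\mathbf M\in\mathbb R^{q\times n}$, the $k$-way Lyapunov matrix is $$\mathcal L_k(\mathbf M)=\mathbf M\otimes\mathbf I_n\otimes\cdots\otimes\mathbf I_n+\mathbf I_n\otimes\mathbf M\otimes\cdots\otimes\mathbf I_n+\cdots+\mathbf I_n\otimes\cdots\otimes\mathbf I_n\otimes\mathbf M\in\mathbb R^{n^{k-1}q\times n^k}$$ ($k$ summands, each with $k$ factors, exactly one of which is $\mathbf M$; $\mathcal L_1(\mathbf M)=\mathbf M$). The vectors on the right-hand sides are defined recursively: $\mathbf w_2=\mathrm{vec}(\mathbf W_2)$, $\mathbf v_2=\mathrm{vec}(\mathbf V_2)$, and for $2<k\le d$, $\mathbf w_k$ (resp. $\mathbf v_k$) is the symmetrization of $\widetilde{\mathbf w}_k$ (resp. $\widetilde{\mathbf v}_k$), and $\mathbf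 W_k,\mathbf V_k\in\mathbb R^{n\times n^{k-1}}$ are the matrices with $\mathrm{vec}(\mathbf W_k)=\mathbf w_k$, $\mathrm{vec}(\mathbf V_k)=\mathbf v_k$. The symmetrization of $\widetilde{\mathbf w}\in\mathbb R^{n^k}$ is its average over all permutations of the $k$ tensor indices, i.e. the unique $\mathbf w$ with $\mathbf w^\top(\mathbf a_1\otimes\cdots\otimes\mathbf a_k)$ invariant under permutations of the $\mathbf a_i\in\mathbb R^n$ and $\mathbf w^\top(\mathbf x\otimes\cdots\otimes\mathbf x)=\widetilde{\mathbf w}^\top(\mathbf x\otimes\cdots\otimes\mathbf x)$ for all $\mathbf x\in\mathbb R^n$. Constant $\gamma_0$. $\gamma_0$ is the smallest $\tilde\gamma$ such that a stabilizing controller exists for which the $\mathcal H_\infty$ norm of the closed-loop system is less than $\tilde\gamma$, for the LTI system $(\mathbf A,\mathbf B,\mathbf C)$ (standard normalized $\mathcal H_\infty$ problem: $\dot{\mathbf x}=\mathbf A\mathbf x+\mathbf B\mathbf w_{(1)}+\mathbf B\mathbf u$, measured output $\mathbf C\mathbf x+\mathbf w_{(2)}$, performance output $(\mathbf C\mathbf x,\mathbf u)$, closed loop from the disturbances $(\mathbf w_{(1)},\mathbf w_{(2)})$ to the performance output). The known fact underlying the assumption $\gamma>\gamma_0$ is that then the two Riccati equations for $\mathbf W_2$ and $\mathbf Y_\infty$ have symmetric positive definite stabilizing solutions, where stabilizing means that $\mathbf A-\eta\mathbf B\mathbf B^\top\mathbf W_2$, respectively $\mathbf A-\eta\mathbf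 Y_\infty\mathbf C^\top\mathbf C$, has all its eigenvalues in the open left half-plane. This may be taken as a hypothesis. *)

(* Defs.v *)
From mathcomp Require Export all_boot all_order all_algebra fingroup perm.
From mathcomp Require Export all_classical all_reals ereal.
From mathcomp Require Export complex mxtens.

Set Implicit Arguments.
Unset Strict Implicit.
Unset Printing Implicit Defensive.

Import Order.TTheory GRing.Theory Num.Theory.
Local Open Scope classical_set_scope.
Local Open Scope ring_scope.

(* Dimensions such as n ^ k.-1 * n and n ^ k are only propositionally equal.
   recast is the transport along such equalities (recastE); its value 0 on
   really different dimensions is junk. The lemmas named *_dim* show that the
   dimensions agree at each use below, for the relevant k (k > 0 for the
   Lyapunov matrices and unvec, k > 2 for the linear systems). *)
Definition recast (R : nzRingType) m n m' n' (M : 'M[R]_(m, n)) : 'M[R]_(m', n') :=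
  conform_mx 0 M.
Arguments recast {R m n m' n'} M.

Lemma recastE (R : nzRingType) m n m' n' (em : m = m') (en : n = n')
  (M : 'M[R]_(m, n)) : recast M = castmx (em, en) M.
Proof. by case: m' / em; case: n' / en; rewrite /recast conform_mx_id castmx_id. Qed.

(* mxvec concatenates rows, hence the transpositions. *)
Definition vec (R : nzRingType) q n (M : 'M[R]_(q, n)) : 'cV[R]_(n * q) :=
  (mxvec M^T)^T.

Definition unvec (R : nzRingType) n k (w : 'cV[R]_(n ^ k)) : 'M[R]_(n, n ^ k.-1) :=
  (vec_mx (recast w^T))^T.

Lemma unvec_dim n k : (0 < k)%N -> (n ^ k = n ^ k.-1 * n)%N.
Proof. by case: k => // k _; rewrite expnSr. Qed.

Lemma vec_unvec (R : nzRingType) n k (w : 'cV[R]_(n ^ k)) :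
  (0 < k)%N -> recast (vec (unvec w)) = w.
Proof.
move=> k_gt0; rewrite /vec /unvec trmxK vec_mxK.
rewrite (recastE (erefl 1%N) (unvec_dim n k_gt0)) trmx_cast /= trmxK.
rewrite (recastE (esym (unvec_dim n k_gt0)) (erefl 1%N)).
by rewrite castmx_comp castmx_id.
Qed.

(* The i-th summand (from 0) is I_n (x) ... (x) M (x) ... (x) I_n with i
   factors I_n on the left of M and k - 1 - i on its right; the Kronecker
   product of i copies of I_n is the identity matrix of size n ^ i. *)
Definition lyap (R : nzRingType) q n (k : nat) (M : 'M[R]_(q, n)) :
    'M[R]_(n ^ k.-1 * q, n ^ k) :=
  \sum_(i < k) recast (tensmx (tensmx (1%:M : 'M[R]_(n ^ i)) M)
                              (1%:M : 'M[R]_(n ^ (k.-1 - i)))).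
Arguments lyap {R q n} k M.

Lemma lyap_dim_row n q k (i : 'I_k) :
  (n ^ i * q * n ^ (k.-1 - i) = n ^ k.-1 * q)%N.
Proof. by case: k i => [[]|k] // i; rewrite mulnAC -expnD subnKC // -ltnS. Qed.

Lemma lyap_dim_col n k (i : 'I_k) : (n ^ i * n * n ^ (k.-1 - i) = n ^ k)%N.
Proof. by case: k i => [[]|k] // i; rewrite lyap_dim_row -expnSr. Qed.

Definition lyap_sq (R : nzRingType) n (k : nat) (M : 'M[R]_n) : 'M[R]_(n ^ k) :=
  recast (lyap k M).
Arguments lyap_sq {R n} k M.

Lemma lyap_sq_dim n k : (0 < k)%N -> (n ^ k.-1 * n = n ^ k)%N.
Proof. by move=> k0; rewrite -unvec_dim. Qed.

Lemma lyap1 (R : nzRingType) q n (M : 'M[R]_(q, n)) : lyap 1 M = recast M.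
Proof.
have e : (1 * q = q)%N by rewrite mul1n.
rewrite /lyap big_ord1 /= (recastE (esym e) (erefl n)).
have e1 : (1 * q * 1 = 1 * q)%N by rewrite muln1.
have e2 : (1 * n * 1 = n)%N by rewrite muln1 mul1n.
rewrite (recastE e1 e2); apply/matrixP => i j.
rewrite !castmxE !mxE /= !ord1 !eqxx mulr1 mul1r.
congr (M _ _); apply: val_inj; rewrite /= ?divn1 modn_small //.
by rewrite -[X in (_ < X)%N]mul1n.
Qed.

(* A coordinate l of R^(n^k) is the tuple of its k base-n digits, the first
   tensor factor being the most significant one (as in tensmx). *)
Definition tdigit (n k : nat) (t : 'I_k) (l : 'I_(n ^ k)) : nat :=
  ((l %/ n ^ (k.-1 - t)) %% n)%N.

(* For each s the inner sum has exactly one term: the coordinate l' whose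
   tuple of indices is that of l permuted by s. *)
Definition symmetrize (R : fieldType) n k (w : 'cV[R]_(n ^ k)) : 'cV[R]_(n ^ k) :=
  \col_l ((k`!)%:R^-1 *
    \sum_(s : 'S_k)
      \sum_(l' < n ^ k | [forall t : 'I_k, tdigit t l' == tdigit (s t) l])
        w l' 0).

Definition quad_sum (R : nzRingType) n m (B : 'M[R]_(n, m))
    (w : forall i, 'cV[R]_(n ^ i)) (k : nat) : 'cV[R]_(n ^ k) :=
  \sum_(i < k.+3) \sum_(j < k.+3 | [&& 2 < i, 2 < j & i + j == k + 2]%N)
    (i * j)%N%:R *: recast (vec ((unvec (w i))^T *m B *m B^T *m unvec (w j))).

Lemma quad_sum_dim n i j k : (2 < i)%N -> (2 < j)%N -> (i + j = k + 2)%N ->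
  (n ^ j.-1 * n ^ i.-1 = n ^ k)%N.
Proof.
case: i => // i; case: j => // j _ _ /=.
by rewrite addSn addnS addn2 => -[] ijk; rewrite -expnD addnC ijk.
Qed.

Definition lyapF_mul (R : nzRingType) n (F : 'M[R]_(n, n ^ 2))
    (w : forall i, 'cV[R]_(n ^ i)) (k : nat) : 'cV[R]_(n ^ k) :=
  recast (lyap k.-1 F^T) *m w k.-1.

Lemma lyapF_dim n k : (2 < k)%N -> (n ^ k.-1.-1 * n ^ 2 = n ^ k)%N.
Proof. by case: k => [|[|k]] // _; rewrite -expnD addn2. Qed.

Definition spd (R : realType) n (M : 'M[R]_n) : Prop :=
  M^T = M /\ forall x : 'cV[R]_n, x != 0 -> 0 < (x^T *m M *m x) 0 0.

Definition to_complex (R : realType) q n (M : 'M[R]_(q, n)) : 'M[R[i]]_(q, n) :=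
  map_mx (real_complex R) M.

Definition hurwitz (R : realType) n (M : 'M[R]_n) : Prop :=
  forall z : R[i], eigenvalue (to_complex M) z -> complex.Re z < 0.

Definition l2norm (R : realType) n (x : 'cV[R[i]]_n) : R :=
  Num.sqrt (\sum_i (complex.Re (x i 0) ^+ 2 + complex.Im (x i 0) ^+ 2)).

(* largest singular value, as the operator norm for the Euclidean norms *)
Definition sigma_max (R : realType) q n (M : 'M[R[i]]_(q, n)) : \bar R :=
  ereal_sup [set (l2norm (M *m x))%:E | x in [set x | l2norm x <= 1]].

Definition transfer (R : realType) N q r (A : 'M[R]_N) (B : 'M[R]_(N, q))
    (C : 'M[R]_(r, N)) (D : 'M[R]_(r, q)) (s : R[i]) : 'M[R[i]]_(r, q) :=
  to_complex C *m invmx (s%:M - to_complex A) *m to_complex B + to_complex D.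

(* H-infinity norm of a stable system (A Hurwitz) *)
Definition hinf_norm (R : realType) N q r (A : 'M[R]_N) (B : 'M[R]_(N, q))
    (C : 'M[R]_(r, N)) (D : 'M[R]_(r, q)) : \bar R :=
  ereal_sup [set sigma_max (transfer A B C D (Complex 0 omega)) | omega in [set: R]].

(* Closed loop of
     x' = A x + B w1 + B u,   measurement y = C x + w2,   performance (C x, u)
   with the controller  xi' = Ak xi + Bk y,  u = Ck xi + Dk y,
   with state (x, xi) and disturbance (w1, w2). *)
Definition cl_A (R : realType) n m p nk
    (A : 'M[R]_n) (B : 'M[R]_(n, m)) (C : 'M[R]_(p, n))
    (Ak : 'M[R]_nk) (Bk : 'M[R]_(nk, p)) (Ck : 'M[R]_(m, nk))
    (Dk : 'M[R]_(m, p)) : 'M[R]_(n + nk) :=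
  block_mx (A + B *m Dk *m C) (B *m Ck)
           (Bk *m C)          Ak.

Definition cl_hinf_norm (R : realType) n m p nk
    (A : 'M[R]_n) (B : 'M[R]_(n, m)) (C : 'M[R]_(p, n))
    (Ak : 'M[R]_nk) (Bk : 'M[R]_(nk, p)) (Ck : 'M[R]_(m, nk))
    (Dk : 'M[R]_(m, p)) : \bar R :=
  hinf_norm (cl_A A B C Ak Bk Ck Dk)
    (block_mx B (B *m Dk)
              0 Bk        : 'M[R]_(n + nk, m + p))
    (block_mx C          0
              (Dk *m C)  Ck : 'M[R]_(p + m, n + nk))
    (block_mx 0 0
              0 Dk : 'M[R]_(p + m, m + p)).

(* The infimum is taken in the extended reals, so that it is +oo if there is
   no stabilizing controller. *)
Definition gamma0 (R : realType) n m p (A : 'M[R]_n) (B : 'M[R]_(n, m))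
    (C : 'M[R]_(p, n)) : \bar R :=
  ereal_inf [set g%:E | g in [set g : R |
    exists (nk : nat) (Ak : 'M[R]_nk) (Bk : 'M[R]_(nk, p))
           (Ck : 'M[R]_(m, nk)) (Dk : 'M[R]_(m, p)),
      hurwitz (cl_A A B C Ak Bk Ck Dk) /\
      (cl_hinf_norm A B C Ak Bk Ck Dk < g%:E)%E]].

(* Main.v *)
Require Import Defs.
From mathcomp Require Import spectral zify.

(* The k summands of L_k(M) commute, so over the complex numbers a singular
   L_k(M) has in its kernel a common eigenvector of all the summands. The
   eigenvalue of each summand there is an eigenvalue of M, hence k >= 1
   eigenvalues of M add up to 0, which is impossible when they all lie in the
   same open half-plane. This applies to A - eta B B^T W2 directly, and to
   A + B B^T V2 because the Riccati equation for Y = V2^-1 gives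
   A + B B^T V2 = - Y (A - eta Y C^T C)^T Y^-1, whose eigenvalues have positive
   real parts. *)

Set Implicit Arguments.
Unset Strict Implicit.
Unset Printing Implicit Defensive.

Import Order.TTheory GRing.Theory Num.Theory.
Local Open Scope ring_scope.

(** * Transport of matrices along equalities of dimensions *)

Lemma recast_id (R : nzRingType) m n (M : 'M[R]_(m, n)) : recast M = M.
Proof. exact: conform_mx_id. Qed.

Lemma recast_comp (R : nzRingType) m n m' n' m'' n'' (M : 'M[R]_(m, n)) :
  m = m' -> n = n' ->
  recast (recast M : 'M[R]_(m', n')) = recast M :> 'M[R]_(m'', n'').
Proof. by move=> <- <-; rewrite recast_id. Qed.

Lemma recast_mul (R : nzRingType) n n' (M N : 'M[R]_n) :
  n = n' -> recast (M *m N) = (recast M : 'M[R]_n') *m (recast N : 'M[R]_n').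
Proof. by move=> <-; rewrite !recast_id. Qed.

Lemma recast_sum (R : nzRingType) m n m' n' (I : finType) (M : I -> 'M[R]_(m, n)) :
  m = m' -> n = n' ->
  recast (\sum_i M i) = \sum_i recast (M i) :> 'M[R]_(m', n').
Proof.
by move=> <- <-; rewrite recast_id; apply: eq_bigr => i _; rewrite recast_id.
Qed.

Lemma recastB (R : nzRingType) m n m' n' (M N : 'M[R]_(m, n)) :
  m = m' -> n = n' -> recast (M - N) = recast M - recast N :> 'M[R]_(m', n').
Proof. by move=> <- <-; rewrite !recast_id. Qed.

Lemma recast_scalar (R : nzRingType) n n' (a : R) :
  n = n' -> recast (a%:M : 'M[R]_n) = a%:M :> 'M[R]_n'.
Proof. by move=> <-; rewrite recast_id. Qed.

Lemma map_recast (R S : nzRingType) (f : {rmorphism R -> S}) m n m' n'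
  (M : 'M[R]_(m, n)) :
  map_mx f (recast M) = recast (map_mx f M) :> 'M[S]_(m', n').
Proof. by rewrite /recast map_conform_mx map_mx0. Qed.

(** * Kronecker products of square matrices *)

Lemma tens_recastl (R : nzRingType) n n' p (M : 'M[R]_n) (N : 'M[R]_p) :
  n = n' -> tensmx (recast M : 'M[R]_n') N = recast (tensmx M N).
Proof. by move=> <-; rewrite !recast_id. Qed.

Lemma tens_recastr (R : nzRingType) n p p' (M : 'M[R]_n) (N : 'M[R]_p) :
  p = p' -> tensmx M (recast N : 'M[R]_p') = recast (tensmx M N).
Proof. by move=> <-; rewrite !recast_id. Qed.

(** With pairs numbered row by row, both nestings give the triple (i, j, k) the same number (i n +
    j) p + k, so only the type changes. *)
Lemma tensmxA (R : nzRingType) m n p (A : 'M[R]_m) (B : 'M[R]_n) (C : 'M[R]_p) :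
  tensmx A (tensmx B C) = recast (tensmx (tensmx A B) C).
Proof.
have e : (m * n * p = m * (n * p))%N by rewrite mulnA.
have cast_index (i : 'I_m) (j : 'I_n) (k : 'I_p) :
  cast_ord (esym e) (mxtens_index (i, mxtens_index (j, k)))
  = mxtens_index (mxtens_index (i, j), k).
  by apply: val_inj; rewrite /= mulnDl mulnA addnA.
rewrite (recastE e e); apply/matrixP => i j.
case: (mxtens_indexP i) => i1 i'; case: (mxtens_indexP i') => i2 i3.
case: (mxtens_indexP j) => j1 j'; case: (mxtens_indexP j') => j2 j3.
by rewrite castmxE !cast_index !tensmxE mulrA.
Qed.

Lemma tensmx11 (R : nzRingType) m n :
  tensmx (1%:M : 'M[R]_m) (1%:M : 'M[R]_n) = 1%:M.
Proof.
apply/matrixP => i j.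
case: (mxtens_indexP i) => i1 i2; case: (mxtens_indexP j) => j1 j2.
rewrite tensmxE !mxE (can_eq (@mxtens_indexK m n)) xpair_eqE.
by case: (i1 == j1); case: (i2 == j2); rewrite ?mulr1 ?mulr0.
Qed.

Lemma tensmxBr (R : nzRingType) m n (A : 'M[R]_m) (B C : 'M[R]_n) :
  tensmx A (B - C) = tensmx A B - tensmx A C.
Proof. by apply/matrixP => i j; rewrite !mxE mulrBr. Qed.

Lemma tensmxBl (R : nzRingType) m n (A B : 'M[R]_m) (C : 'M[R]_n) :
  tensmx (A - B) C = tensmx A C - tensmx B C.
Proof. by apply/matrixP => i j; rewrite !mxE mulrBl. Qed.

Lemma tens_scalarr (R : comNzRingType) m n (a : R) :
  tensmx (1%:M : 'M[R]_m) (a%:M : 'M[R]_n) = a%:M.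
Proof.
rewrite -[a%:M in RHS]scalemx1 -tensmx11 -[a%:M]scalemx1.
by apply/matrixP => i j; rewrite !mxE mulrCA.
Qed.

Lemma tens_scalarl (R : comNzRingType) m n (a : R) :
  tensmx (a%:M : 'M[R]_m) (1%:M : 'M[R]_n) = a%:M.
Proof.
rewrite -[a%:M in RHS]scalemx1 -tensmx11 -[a%:M]scalemx1.
by apply/matrixP => i j; rewrite !mxE mulrA.
Qed.

(** * The summands of the Lyapunov matrix as square matrices, and their commutation *)

Definition site (R : nzRingType) n k (i : 'I_k) (M : 'M[R]_n) : 'M[R]_(n ^ k) :=
  recast (tensmx (tensmx (1%:M : 'M[R]_(n ^ i)) M)
                 (1%:M : 'M[R]_(n ^ (k.-1 - i)))).

Lemma lyap_sqE (R : nzRingType) n k (M : 'M[R]_n) :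
  (0 < k)%N -> lyap_sq k M = \sum_i site (i : 'I_k) M.
Proof.
move=> k_gt0; rewrite /lyap_sq recast_sum //; last exact: lyap_sq_dim.
apply: eq_bigr => i _; apply: recast_comp; [exact: lyap_dim_row|].
exact: lyap_dim_col.
Qed.

(** Together with [siteB] and [site_scalar], this makes [site i] a unital ring morphism, which
    therefore carries inverses to inverses. *)
Lemma siteM (R : comNzRingType) n k (i : 'I_k) (M N : 'M[R]_n) :
  site i (M *m N) = site i M *m site i N.
Proof. by rewrite -recast_mul ?lyap_dim_col // !tensmx_mul !mulmx1. Qed.

Lemma siteB (R : nzRingType) n k (i : 'I_k) (M N : 'M[R]_n) :
  site i (M - N) = site i M - site i N.
Proof. by rewrite /site -recastB ?lyap_dim_col // tensmxBr tensmxBl. Qed.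

Lemma site_scalar (R : comNzRingType) n k (i : 'I_k) (a : R) :
  site i (a%:M : 'M[R]_n) = a%:M.
Proof. by rewrite /site tens_scalarr tens_scalarl recast_scalar ?lyap_dim_col. Qed.

(* Regrouping the factors as R^(n^j) (x) R^(n^(k-j)), the i-th site acts on the
   left factor only and the j-th one on the right factor only. *)
Lemma site_comm_lt (R : comNzRingType) n k (i j : 'I_k) (M N : 'M[R]_n) :
  (i < j)%N -> comm_mx (site i M) (site j N).
Proof.
move=> lt_ij.
have j_le : (j <= k)%N by exact: ltnW.
have k_gt0 : (0 < k)%N by exact: leq_ltn_trans (ltn_ord j).
have eL : (n ^ i * n * n ^ (j.-1 - i) = n ^ j)%N.
  exact: (lyap_dim_col n (Ordinal lt_ij)).
have eR : (n * n ^ (k.-1 - j) = n ^ (k - j))%N.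
  by rewrite -expnS -subSn ?prednK // -ltnS prednK.
have eM : (n ^ (j.-1 - i) * n ^ (k - j) = n ^ (k.-1 - i))%N.
  by rewrite -expnD; congr (_ ^ _)%N; lia.
have ek : (n ^ j * n ^ (k - j) = n ^ k)%N by rewrite -expnD subnKC.
have -> : site i M = recast (tensmx (recast (tensmx (tensmx
    (1%:M : 'M[R]_(n ^ i)) M) (1%:M : 'M[R]_(n ^ (j.-1 - i)))) : 'M[R]_(n ^ j))
    (1%:M : 'M[R]_(n ^ (k - j)))).
  rewrite tens_recastl // recast_comp; try by rewrite eL.
  (* The identity to the right of [M] splits in two: a factor of size n^(j-1-i) completes the left
     block, and one of size n^(k-j) is the right block. *)
  rewrite /site -(recast_scalar _ eM) tens_recastr // recast_comp; try by rewrite eM.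
  by rewrite -tensmx11 tensmxA recast_comp // mulnA.
have -> : site j N = recast (tensmx (1%:M : 'M[R]_(n ^ j))
    (recast (tensmx N (1%:M : 'M[R]_(n ^ (k.-1 - j)))) : 'M[R]_(n ^ (k - j)))).
  rewrite tens_recastr // recast_comp; try by rewrite eR.
  by rewrite tensmxA recast_comp // mulnA.
by rewrite /comm_mx -!recast_mul // !tensmx_mul !mul1mx !mulmx1.
Qed.

Lemma site_comm (R : comNzRingType) n k (i j : 'I_k) (M : 'M[R]_n) :
  comm_mx (site i M) (site j M).
Proof.
case: (ltngtP i j) => [|ji|/val_inj->//]; first exact: site_comm_lt.
exact/comm_mx_sym/site_comm_lt.
Qed.

(** * Eigenvalues of the summands and invertibility of their sum *)

Lemma eigenvalue_unit (F : fieldType) n (M : 'M[F]_n) a :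
  eigenvalue M a = (M - a%:M \notin unitmx).
Proof. by rewrite /eigenvalue /eigenspace kermx_eq0 row_free_unit. Qed.

Lemma eigenvalue_tr (F : fieldType) n (M : 'M[F]_n) a :
  eigenvalue M^T a = eigenvalue M a.
Proof. by rewrite !eigenvalue_unit -(unitmx_tr (M - _)) linearB /= tr_scalar_mx. Qed.

(** By contraposition: an inverse of M - a is sent by [site i] to an inverse of [site i M] - a. *)
Lemma eigenvalue_site (F : fieldType) n k (i : 'I_k) (M : 'M[F]_n) a :
  eigenvalue (site i M) a -> eigenvalue M a.
Proof.
rewrite !eigenvalue_unit -(site_scalar n i) -siteB; apply: contra => uM.
have: site i (M - a%:M) *m site i (invmx (M - a%:M)) = 1%:M.
  by rewrite -siteM mulmxV // site_scalar.
by case/mulmx1_unit.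
Qed.

(** In a basis [B] of [V], the restrictions of the [f i] become square matrices [g i] that still
    commute; a common eigenvector [u] of these is mapped back to [u *m B]. *)
Lemma stablemx_common_eigenvector (C : numClosedFieldType) n (I : finType)
    (f : I -> 'M[C]_n) m (V : 'M[C]_(m, n)) :
  V != 0 -> (forall i j, comm_mx (f i) (f j)) -> (forall i, stablemx V (f i)) ->
  exists v : 'rV[C]_n, [/\ v != 0, (v <= V)%MS &
    exists a : I -> C, forall i, v *m f i = a i *: v].
Proof.
move=> V0 f_comm f_stab; set B := row_base V.
have B_free : row_free B by exact: row_base_free.
have [g gB] : exists g : I -> 'M_(\rank V), forall i, g i *m B = B *m f i.
  by exists (fun i => B *m f i *m pinvmx B) => i; rewrite mulmxKpV ?stablemx_row_base.
have rV : (0 < \rank V)%N by rewrite lt0n mxrank_eq0.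
have g_comm : {in [seq g i | i <- enum I] &, forall A B, comm_mx A B}.
  move=> _ _ /mapP[i _ ->] /mapP[j _ ->]; apply: (row_free_inj B_free).
  rewrite -(mulmxA (g i)) -(mulmxA (g j)) !gB 2!mulmxA !gB.
  by rewrite -!mulmxA f_comm.
have [u u0 /allP ug] := common_eigenvector rV g_comm.
exists (u *m B); split.
- by rewrite mulmx_free_eq0.
- by rewrite (submx_trans (submxMl _ _)) // eq_row_base.
- have /fin_all_exists[a ua] : forall i, exists a, u *m g i = a *: u.
    move=> i; have /sub_rVP[a ->] : (u *m g i <= u)%MS; last by exists a.
    by apply/ug/mapP; exists i; rewrite ?mem_enum.
  by exists a => i; rewrite -mulmxA -gB mulmxA ua scalemxAl.
Qed.

Lemma lyap_sq_unit (C : numClosedFieldType) n k (M : 'M[C]_n) :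
  (0 < k)%N ->
  (forall a : 'I_k -> C, (forall i, eigenvalue M (a i)) -> \sum_i a i != 0) ->
  lyap_sq k M \in unitmx.
Proof.
move=> k_gt0 sum_neq0; rewrite -row_free_unit -kermx_eq0; apply/negPn/negP => K0.
(* Each summand commutes with the whole sum and so preserves its left kernel. *)
have stab i : stablemx (kermx (lyap_sq k M)) (site (i : 'I_k) M).
  apply: comm_mx_stable_ker; rewrite lyap_sqE //; apply: comm_mx_sym.
  by apply: comm_mx_sum => j _; apply: site_comm.
have [v [v0 /sub_kermxP vL [a va]]] :=
  stablemx_common_eigenvector K0 (fun i j => @site_comm _ n k i j M) stab.
suff /eqP: (\sum_i a i) *: v = 0.
  rewrite scaler_eq0 (negPf v0) orbF; apply/negP/sum_neq0 => i.
  by apply: (@eigenvalue_site _ _ _ i); apply/eigenvalueP; exists v.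
rewrite -[RHS]vL scaler_suml lyap_sqE // mulmx_sumr.
by apply: eq_bigr => i _; rewrite va.
Qed.

Lemma lyap_sqN (R : nzRingType) n k (M : 'M[R]_n) :
  (0 < k)%N -> lyap_sq k (- M) = - lyap_sq k M.
Proof.
move=> k_gt0; rewrite !lyap_sqE // -sumrN; apply: eq_bigr => i _.
(* Writing - M as (0 - 0) - M lets [siteB] alone deal with the zero as well. *)
by rewrite -[- M]sub0r -(subrr 0) !siteB !subrr !sub0r.
Qed.

(** * Real matrices with all eigenvalues in the open left half-plane *)

Lemma map_lyap_sq (R S : nzRingType) (f : {rmorphism R -> S}) n k (M : 'M[R]_n) :
  (0 < k)%N -> map_mx f (lyap_sq k M) = lyap_sq k (map_mx f M).
Proof.
move=> k_gt0; rewrite !lyap_sqE // raddf_sum; apply: eq_bigr => i _.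
by rewrite /= map_recast !map_mxT !map_mx1.
Qed.

Lemma lyap_sq_hurwitz_unit (R : realType) n k (M : 'M[R]_n) :
  (0 < k)%N -> hurwitz M -> lyap_sq k M \in unitmx.
Proof.
move=> k_gt0 HM; rewrite -(map_unitmx (real_complex R)) map_lyap_sq //.
apply: lyap_sq_unit => // a eig_a; apply/eqP => /(congr1 (@complex.Re R)).
rewrite raddf_sum /=; apply/eqP; rewrite lt_eqF //.
(* Since k > 0 there is a first eigenvalue; its real part is negative and the others add nothing
   positive. *)
case: k k_gt0 a eig_a => // k _ a eig_a.
rewrite big_ord_recl /= ltr_wnDr //; last exact/HM/eig_a.
by apply: sumr_le0 => i _; exact/ltW/HM/eig_a.
Qed.

Lemma hurwitz_tr (R : realType) n (M : 'M[R]_n) : hurwitz M -> hurwitz M^T.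
Proof. by move=> HM z; rewrite /to_complex -matrix.map_trmx eigenvalue_tr; apply: HM. Qed.

(** A left eigenvector v of P^-1 M P yields the left eigenvector v P^-1 of M, with the same
    eigenvalue. *)
Lemma hurwitz_conj (R : realType) n (P M : 'M[R]_n) :
  P \in unitmx -> hurwitz M -> hurwitz (invmx P *m M *m P).
Proof.
move=> uP HM z /eigenvalueP[v]; rewrite /to_complex !map_mxM /= => vz v0.
pose Q := map_mx (real_complex R) (invmx P).
have PQ : map_mx (real_complex R) P *m Q = 1%:M by rewrite -map_mxM mulmxV ?map_mx1.
have QP : Q *m map_mx (real_complex R) P = 1%:M by rewrite -map_mxM mulVmx ?map_mx1.
apply/HM/eigenvalueP; exists (v *m Q).
  by rewrite scalemxAl -vz -!mulmxA PQ mulmx1.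
apply: contra_neq v0 => vQ0.
by rewrite -[v]mulmx1 -QP mulmxA vQ0 mul0mx.
Qed.

(** A nonzero row u with u M = 0 would make the quadratic form vanish at u^T. *)
Lemma spd_unit (R : realType) n (M : 'M[R]_n) : spd M -> M \in unitmx.
Proof.
case=> _ M_pos; rewrite -row_free_unit -kermx_eq0; apply/negPn/negP.
case/rowV0Pn => u /sub_kermxP uM u0.
by have := M_pos u^T; rewrite trmxK uM mul0mx mxE ltxx trmx_eq0 => /(_ u0).
Qed.

(** * Recursive solution of the linear systems *)

Lemma quad_sum_ext (R : nzRingType) n m (B : 'M[R]_(n, m))
    (w w' : forall i, 'cV[R]_(n ^ i)) k :
  (forall i, (i < k)%N -> w i = w' i) -> quad_sum B w k = quad_sum B w' k.
Proof.
move=> ww; apply: eq_bigr => i _; apply: eq_bigr => j /and3P[i2 j2 /eqP ijk].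
(* Two indices that are at least 3 and add up to k + 2 are both at most k - 1. *)
by rewrite !ww //; lia.
Qed.

Lemma lyapF_mul_ext (R : nzRingType) n (F : 'M[R]_(n, n ^ 2))
    (w w' : forall i, 'cV[R]_(n ^ i)) k :
  (0 < k)%N -> (forall i, (i < k)%N -> w i = w' i) ->
  lyapF_mul F w k = lyapF_mul F w' k.
Proof. by move=> k_gt0 ww; rewrite /lyapF_mul ww // ltn_predL. Qed.

(** Iterating [f] from any family [t] freezes the entries below s after s steps, because entry k of
    the image depends only on earlier entries. The diagonal of the iterates is then a fixed
    point. *)
Lemma causal_fixpoint (T : nat -> Type) (t : forall k, T k)
    (f : (forall k, T k) -> forall k, T k) :
  (forall (w w' : forall k, T k) k,
     (forall i, (i < k)%N -> w i = w' i) -> f w k = f w' k) ->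
  exists w : forall k, T k, forall k, w k = f w k.
Proof.
move=> f_ext; pose u s := iter s f t.
have u_stable s : forall i, (i < s)%N -> forall s', (s <= s')%N -> u s i = u s' i.
  elim: s => // s IHs i; rewrite ltnS => le_is [//|s']; rewrite ltnS => le_ss'.
  apply: f_ext => j lt_ji.
  by apply: IHs => //; exact: leq_trans le_is.
exists (fun k => u k.+1 k) => k; apply: f_ext => i lt_ik.
by rewrite (u_stable i.+1 _ _ k).
Qed.

(** Covers the [w] and the [v] recursions at once: invertibility gives each solution, and a causal
    fixed point ties them together. *)
Lemma symmetrized_systems (R : fieldType) n (L : forall k, 'M[R]_(n ^ k))
    (w2 : 'cV[R]_(n ^ 2))
    (rhs : (forall k, 'cV[R]_(n ^ k)) -> forall k, 'cV[R]_(n ^ k)) d :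
  (forall k, (2 < k <= d)%N -> L k \in unitmx) ->
  (forall w w' k, (2 < k)%N -> (forall i, (i < k)%N -> w i = w' i) ->
     rhs w k = rhs w' k) ->
  exists w wt : forall k : nat, 'cV[R]_(n ^ k),
    w 2%N = w2 /\
    forall k : nat, (2 < k <= d)%N ->
      unique (fun x : 'cV[R]_(n ^ k) => L k *m x = rhs w k) (wt k)
      /\ w k = symmetrize (wt k).
Proof.
move=> uL rhs_ext.
pose f w k : 'cV[R]_(n ^ k) :=
  match k with
  | 2 => w2
  | k => symmetrize (invmx (L k) *m rhs w k)
  end.
have fE w k : (2 < k)%N -> f w k = symmetrize (invmx (L k) *m rhs w k).
  by case: k => [|[|[|k]]].
(* The right-hand side is known to be causal only for k > 2, so entries 0 and 1 are set to the
   default value 0. *)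
pose g w k := if (2 <= k)%N then f w k else 0.
have [w wE] : exists w : forall k, 'cV[R]_(n ^ k), forall k, w k = g w k.
  apply: causal_fixpoint (fun=> 0) _ _ => w w' k ww; rewrite /g.
  case: (ltngtP 2 k) => // k2; first by rewrite !fE // (rhs_ext _ w').
  by case: k / k2 ww.
exists w, (fun k => invmx (L k) *m rhs w k); split; first exact: wE.
move=> k k2d; have /andP[k2 _] := k2d; have Lk := uL k k2d; split.
  split=> [|x <-]; first by rewrite mulKVmx.
  by rewrite mulKmx.
by rewrite wE /g ltnW // fE.
Qed.

(** * Application to the two Riccati equations *)

Theorem theorem6 (R : realType) (n m p : nat)
  (A : 'M[R]_n) (F : 'M[R]_(n, n ^ 2)) (B : 'M[R]_(n, m)) (C : 'M[R]_(p, n))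
  (gamma eta : R) (d : nat) (W2 V2 Yoo : 'M[R]_n)
  (hgamma : (0 <= gamma0 A B C < gamma%:E)%E)
  (heta : eta = 1 - gamma ^- 2)
  (hd : (2 <= d)%N)
  (W2_spd : spd W2)
  (W2_riccati :
     0 = A^T *m W2 + W2 *m A + C^T *m C - eta *: (W2 *m B *m B^T *m W2))
  (W2_stab : hurwitz (A - eta *: (B *m B^T *m W2)))
  (Yoo_spd : spd Yoo)
  (Yoo_riccati :
     A *m Yoo + Yoo *m A^T + B *m B^T - eta *: (Yoo *m C^T *m C *m Yoo) = 0)
  (Yoo_stab : hurwitz (A - eta *: (Yoo *m C^T *m C)))
  (hV2 : V2 = invmx Yoo) :
  let AW := (A - eta *: (B *m B^T *m W2))^T in
  let AV := (A + B *m B^T *m V2)^T in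
  [/\ 0 = A^T *m V2 + V2 *m A - eta *: (C^T *m C) + V2 *m B *m B^T *m V2,
      forall k : nat, (1 <= k <= d)%N ->
        lyap_sq k AW \in unitmx /\ lyap_sq k AV \in unitmx,
      exists w wt : forall k : nat, 'cV[R]_(n ^ k),
        w 2%N = vec W2 /\
        forall k : nat, (2 < k <= d)%N ->
          unique (fun x : 'cV[R]_(n ^ k) =>
                    lyap_sq k AW *m x
                    = - lyapF_mul F w k + (eta / 4) *: quad_sum B w k)
                 (wt k)
          /\ w k = symmetrize (wt k)
    & exists v vt : forall k : nat, 'cV[R]_(n ^ k),
        v 2%N = vec V2 /\
        forall k : nat, (2 < k <= d)%N ->
          unique (fun x : 'cV[R]_(n ^ k) =>
                    lyap_sq k AV *m x
                    = - lyapF_mul F v k - (1 / 4) *: quad_sum B v k)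
                 (vt k)
          /\ v k = symmetrize (vt k)].
Proof.
move=> AW AV; have Y_unit := spd_unit Yoo_spd; have [Y_sym _] := Yoo_spd.
have VY : V2 *m Yoo = 1%:M by rewrite hV2 mulVmx.
have YV : Yoo *m V2 = 1%:M by rewrite hV2 mulmxV.
have V_riccati :
    0 = A^T *m V2 + V2 *m A - eta *: (C^T *m C) + V2 *m B *m B^T *m V2.
  (* The equation for [V2] is the one for [Yoo] multiplied on both sides by [V2], the inverse of
     [Yoo]. *)
  have := congr1 (fun M => V2 *m M *m V2) Yoo_riccati.
  rewrite mulmx0 mul0mx => <-.
  rewrite !(mulmxDl, mulmxDr, mulNmx, mulmxN) -scalemxAr -scalemxAl.
  rewrite !mulmxA VY !mul1mx -!mulmxA YV !mulmx1 !mulmxA.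
  by rewrite (addrC (A^T *m _)) -!addrA; congr (_ + (_ + _)); rewrite addrC.
have AW_hurwitz : hurwitz AW by exact: hurwitz_tr.
have AV_hurwitz : hurwitz (- AV).
  suff -> : - AV = invmx Yoo *m (A - eta *: (Yoo *m C^T *m C)) *m Yoo.
    exact: hurwitz_conj.
  rewrite -hV2; have V_sym : V2^T = V2 by rewrite hV2 trmx_inv Y_sym.
  rewrite /AV linearD /= !trmx_mul V_sym trmxK.
  (* Inserting [V2 *m Yoo] exposes A^T V2, which the equation for [V2] then replaces; its quadratic
     term cancels the V2 B B^T in [AV]. *)
  have -> : A^T = A^T *m V2 *m Yoo by rewrite -mulmxA VY mulmx1.
  have -> : A^T *m V2 = - (V2 *m A - eta *: (C^T *m C) + V2 *m B *m B^T *m V2).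
    by apply/eqP; rewrite -addr_eq0 !addrA -V_riccati.
  rewrite mulNmx !(mulmxDl, mulmxDr, mulmxN, mulNmx) -!scalemxAl -!scalemxAr.
  rewrite !mulmxA VY mul1mx -(mulmxA (V2 *m B *m B^T)) VY mulmx1.
  by rewrite opprD opprK addrK -scalemxAl.
have L_unit k : (0 < k)%N -> lyap_sq k AW \in unitmx /\ lyap_sq k AV \in unitmx.
  move=> k_gt0; split; first exact: lyap_sq_hurwitz_unit.
  (* Invertibility passes from - [AV] to [AV] because the Lyapunov matrix is odd in its argument. *)
  rewrite -[lyap_sq k AV]opprK -scaleN1r unitmxZ ?unitrN1 // -lyap_sqN //.
  exact: lyap_sq_hurwitz_unit.
split=> // [k /andP[k_gt0 _]||].
- exact: L_unit.
- apply: (@symmetrized_systems _ _ (fun k => lyap_sq k AW) (vec W2)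
    (fun w k => - lyapF_mul F w k + (eta / 4) *: quad_sum B w k)).
    by move=> k /andP[k2 _]; have [] := L_unit k (ltn_trans (isT : 0 < 2)%N k2).
  move=> w w' k k2 ww.
  by rewrite (lyapF_mul_ext F _ ww) 1?(quad_sum_ext B ww) // (ltn_trans _ k2).
- apply: (@symmetrized_systems _ _ (fun k => lyap_sq k AV) (vec V2)
    (fun v k => - lyapF_mul F v k - (1 / 4) *: quad_sum B v k)).
    by move=> k /andP[k2 _]; have [] := L_unit k (ltn_trans (isT : 0 < 2)%N k2).
  move=> w w' k k2 ww.
  by rewrite (lyapF_mul_ext F _ ww) 1?(quad_sum_ext B ww) // (ltn_trans _ k2).
Qed.
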